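(* Let $h(p,v)$ be the collision cone barrier of a splat, $h(p,v)=(v^\top A v)(r^\top A r-c^2)-(r^\top A v)^2$ with $r=\mu-p$, which is continuously differentiable in $(p,v)\in\mathbb{R}^3\times\mathbb{R}^3$. Let $a_{\mathrm{cmd}}\in\mathbb{R}^3$ be the translational acceleration commanded by the double-integrator safety filter, let $a_{\mathrm{real}}:=\dot v=-g e_3+\tfrac{T}{m}R(\sigma)^\top e_3$ be the acceleration realized by the quadrotor, and let $e_a:=a_{\mathrm{real}}-a_{\mathrm{cmd}}$ be the realization error. Let $\dot h_{\mathrm{real}}$ denote the time derivative of $h(p,v)$ at the current $(p,v)$ along the true quadrotor dynamics (where $\dot p=v$, $\dot v=a_{\mathrm{real}}$), and let $\dot h_{\mathrm{DI}}$ denote the time derivative of $h(p,v)$ at the same $(p,v)$ predicted by the reduced-order double-integrator model (where $\dot p=v$, $\dot v=a_{\mathrm{cmd}}$). Then $$\dot h_{\mathrm{real}}=\dot h_{\mathrm{DI}}+\nabla_v h(p,v)^\top e_a .$$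
   Context: Quadrotor: position $p\in\mathbb{R}^3$, velocity $v\in\mathbb{R}^3$, attitude given by Modified Rodrigues Parameters $\sigma\in\mathbb{R}^3$ with rotation matrix $R(\sigma)\in\mathrm{SO}(3)$, total thrust $T\ge 0$, mass $m>0$, gravitational acceleration $g>0$, $e_3=(0,0,1)^\top$. Translational dynamics: $\dot p=v$, $m\dot v=-mg e_3+T R(\sigma)^\top e_3$. The reduced-order double-integrator (DI) model is $\dot p=v$, $\dot v=a_{\mathrm{cmd}}$. Obstacle (Gaussian splat): an ellipsoid with center $\mu\in\mathbb{R}^3$, symmetric positive definite shape matrix $A\in\mathbb{R}^{3\times3}$ (the inverse covariance $\Sigma^{-1}$ of the splat) and constant $c>0$, i.e. $\{x:(x-\mu)^\top A(x-\mu)\le c^2\}$. The splat is static ($\mu,A,c$ constant in time). $\nabla_p h$, $\nabla_v h$ denote the gradients of $h$ with respect to $p$ and $v$. *)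

(* Defs.v *)
From mathcomp Require Export all_boot all_order all_algebra.
From mathcomp Require Export ring.
From mathcomp Require Export boolp classical_sets reals topology normedtype derive.
Export numFieldNormedType.Exports.

Set Implicit Arguments.
Unset Strict Implicit.
Unset Printing Implicit Defensive.
Import Order.TTheory GRing.Theory Num.Theory.
Local Open Scope ring_scope.

Definition dot (R : realType) (n : nat) (x y : 'cV[R]_n) : R := (x^T *m y) 0 0.

(* [x^T A y] *)
Definition bilin (R : realType) (n : nat) (A : 'M[R]_n) (x y : 'cV[R]_n) : R :=
  (x^T *m A *m y) 0 0.

Definition sym_posdef (R : realType) (n : nat) (A : 'M[R]_n) : Prop :=
  A^T = A /\ forall x : 'cV[R]_n, x != 0 -> 0 < bilin A x x.

Definition gradient (R : realType) (n : nat) (f : 'cV[R]_n -> R) (x : 'cV[R]_n) :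
    'cV[R]_n :=
  \col_i 'D_(delta_mx i 0) f x.

Definition grad_p (R : realType) (f : 'cV[R]_3 -> 'cV[R]_3 -> R)
    (p v : 'cV[R]_3) : 'cV[R]_3 :=
  gradient (fun q => f q v) p.

Definition grad_v (R : realType) (f : 'cV[R]_3 -> 'cV[R]_3 -> R)
    (p v : 'cV[R]_3) : 'cV[R]_3 :=
  gradient (fun w => f p w) v.

(* Joint C^1 regularity: [grad_p f] and [grad_v f] collect all six partial
   derivatives of [f]. *)
Definition continuously_differentiable (R : realType)
    (f : 'cV[R]_3 -> 'cV[R]_3 -> R) : Prop :=
  [/\ forall z : 'cV[R]_3 * 'cV[R]_3, differentiable (fun y => f y.1 y.2) z,
      continuous (fun z : 'cV[R]_3 * 'cV[R]_3 => grad_p f z.1 z.2) &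
      continuous (fun z : 'cV[R]_3 * 'cV[R]_3 => grad_v f z.1 z.2)].

Definition collision_cone (R : realType) (mu : 'cV[R]_3) (A : 'M[R]_3) (c : R)
    (p v : 'cV[R]_3) : R :=
  let r := mu - p in
  bilin A v v * (bilin A r r - c ^+ 2) - bilin A r v ^+ 2.

Definition e3 (R : realType) : 'cV[R]_3 := delta_mx 2%:R 0.

Definition cross_mx (R : realType) (s : 'cV[R]_3) : 'M[R]_3 :=
  let x := s 0 0 in let y := s 1 0 in let z := s 2%:R 0 in
  \matrix_(i, j) nth 0 (nth [::] [:: [::   0; - z;   y];
                                     [::   z;   0; - x];
                                     [:: - y;   x;   0]] i) j.

(* Direction cosine matrix of the Modified Rodrigues Parameters
   s = tan (phi / 4) *: (unit axis), mapping inertial to body coordinates;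
   its transpose therefore maps the body thrust axis to the inertial frame. *)
Definition mrp_rot (R : realType) (s : 'cV[R]_3) : 'M[R]_3 :=
  let n2 := dot s s in
  1%:M - (4 * (1 - n2) / (1 + n2) ^+ 2) *: cross_mx s
       + (8 / (1 + n2) ^+ 2) *: (cross_mx s *m cross_mx s).

Lemma mrp_rot_SO3 (R : realType) (s : 'cV[R]_3) :
  mrp_rot s *m (mrp_rot s)^T = 1%:M /\ \det (mrp_rot s) = 1.
Proof.
have n2E : dot s s = s 0 0 ^+ 2 + s 1 0 ^+ 2 + s 2%:R 0 ^+ 2.
  rewrite /dot mxE !big_ord_recl big_ord0 !mxE addr0 addrA !expr2.
  by congr (_ * _ + _ * _ + _ * _); congr (s _ _); apply/val_inj.
have n2_neq0 : 1 + dot s s != 0.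
  by rewrite gt_eqF// n2E ltr_wpDr// !addr_ge0 ?sqr_ge0.
have E (i j : 'I_3) : mrp_rot s i j =
    let n2 := dot s s in
    let x := s 0 0 in let y := s 1 0 in let z := s 2%:R 0 in
    let a := 4 * (1 - n2) / (1 + n2) ^+ 2 in let b := 8 / (1 + n2) ^+ 2 in
    nth 0 (nth [::]
      [:: [:: 1 - b * (y ^+ 2 + z ^+ 2); a * z + b * (x * y); - (a * y) + b * (x * z)];
          [:: - (a * z) + b * (x * y); 1 - b * (x ^+ 2 + z ^+ 2); a * x + b * (y * z)];
          [:: a * y + b * (x * z); - (a * x) + b * (y * z); 1 - b * (x ^+ 2 + y ^+ 2)]]
      i) j.
  rewrite /mrp_rot !mxE !big_ord_recl big_ord0 !mxE.
  by case: i => [[|[|[|//]]] ?]; case: j => [[|[|[|//]]] ?]; rewrite /= /bump /=; ring.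
move: (mrp_rot s) E => M E; split.
  apply/matrixP => i j; rewrite !mxE !big_ord_recl big_ord0 !mxE !E.
  by case: i => [[|[|[|//]]] ?]; case: j => [[|[|[|//]]] ?];
    rewrite /= /bump /= ?n2E; rewrite n2E in n2_neq0; field.
rewrite (expand_det_row _ 0) !big_ord_recl big_ord0 /cofactor.
rewrite !(expand_det_row (n := 2) _ 0) !big_ord_recl !big_ord0 /cofactor !det_mx11.
rewrite !mxE !E /= /bump /= n2E; rewrite n2E in n2_neq0.
by field.
Qed.

Definition accel_real (R : realType) (m g T : R) (s : 'cV[R]_3) : 'cV[R]_3 :=
  - g *: e3 R + (T / m) *: ((mrp_rot s)^T *m e3 R).

(* The translational equations of motion at the instant [t]. *)
Definition quadrotor_dynamics (R : realType) (m g : R) (T : R -> R)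
    (sigma p v : R -> 'cV[R]_3) (t : R) : Prop :=
  [/\ is_derive t 1 p (v t), derivable v t 1 &
      m *: 'D_1 v t = - (m * g) *: e3 R + T t *: ((mrp_rot (sigma t))^T *m e3 R)].

Definition double_integrator (R : realType) (a_cmd p v : R -> 'cV[R]_3) (t : R) :
    Prop :=
  is_derive t 1 p (v t) /\ is_derive t 1 v (a_cmd t).

(* Main.v *)
(* Along any motion, the chain rule gives dh/dt = dh_(p,v)(p', v'). The true and
   the predicted motions share p' = v and the base point, so by linearity the two
   rates differ by dh_(p,v)(0, e_a) = <grad_v h, e_a>. *)
Require Import Defs.
From mathcomp Require Import functions.
Import Order.TTheory GRing.Theory Num.Theory.
Local Open Scope ring_scope.

(** Turns the matrix product into scalar sums and products of entries, the form in which the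
    differentiation rules apply. *)
Lemma bilinE (R : realType) n (A : 'M[R]_n) (x y : 'cV[R]_n) :
  bilin A x y = \sum_i \sum_j A j i * (x j 0 * y i 0).
Proof.
rewrite /bilin mxE; apply: eq_bigr => i _; rewrite mxE big_distrl/=.
by apply: eq_bigr => j _; rewrite !mxE mulrAC mulrC.
Qed.

Section Bilin.
Context {R : realType} {V : normedModType R} {n : nat} (A : 'M[R]_n).
Implicit Types f g : V -> 'cV[R]_n.

Lemma is_derive_entry f x u (df : 'cV[R]_n) i :
  is_derive x u f df -> is_derive x u (fun y => f y i 0) (df i 0).
Proof.
move=> [dvf <-]; rewrite derive_mx// mxE; apply: derivableP.
exact: (derivable_mxP _ _ _).1.
Qed.

Lemma is_derive_bilin f g x u (df dg : 'cV[R]_n) :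
  is_derive x u f df -> is_derive x u g dg ->
  is_derive x u (fun y => bilin A (f y) (g y)) (bilin A df (g x) + bilin A (f x) dg).
Proof.
move=> hf hg.
(* The sum is taken in the ring of functions, so that the rules for sums, scalings and products of
   functions match it syntactically. *)
have -> : (fun y => bilin A (f y) (g y)) =
    \sum_i \sum_j A j i \*: ((fun y => f y j 0) * (fun y => g y i 0)).
  apply/funext => y; rewrite bilinE fct_sumE; apply: eq_bigr => i _.
  by rewrite fct_sumE.
apply: is_derive_eq.
  apply: is_derive_sum => i; apply: is_derive_sum => j.
  by apply: is_deriveZ; apply: is_deriveM; exact: is_derive_entry.
rewrite !bilinE -big_split; apply: eq_bigr => i _.
rewrite -big_split; apply: eq_bigr => j _ /=.
by rewrite -mulrDr addrC; congr (_ * (_ + _)); rewrite /GRing.scale /= mulrC.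
Qed.

Lemma differentiable_bilin f g x :
  differentiable f x -> differentiable g x ->
  differentiable (fun y => bilin A (f y) (g y)) x.
Proof.
move=> hf hg.
have entry k i : differentiable k x -> differentiable (fun y => (k y : 'cV[R]_n) i 0) x.
  by move=> hk; exact: (differentiable_comp hk (@differentiable_coord _ _ _ (k x) i 0)).
have -> : (fun y => bilin A (f y) (g y)) =
    \sum_i \sum_j A j i \*: ((fun y => f y j 0) * (fun y => g y i 0)).
  apply/funext => y; rewrite bilinE fct_sumE; apply: eq_bigr => i _.
  by rewrite fct_sumE.
apply: differentiable_sum => i; apply: differentiable_sum => j.
by apply: differentiableZ; apply: differentiableM; exact: entry.
Qed.

End Bilin.

Arguments is_derive_bilin {R V n A f g x u df dg}.

(** A column is the finite sum of its entries times basis columns, and addition and scaling are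
    continuous. *)
Lemma continuous_col (R : realType) n (T : topologicalType) (f : T -> 'cV[R]_n) :
  (forall i, continuous (fun y => f y i 0)) -> continuous f.
Proof.
move=> hf x.
rewrite (_ : f = fun y => \sum_i f y i 0 *: delta_mx i 0); last first.
  apply/funext => y; rewrite {1}[f y]matrix_sum_delta.
  by apply: eq_bigr => i _; rewrite big_ord1.
apply: cvg_big => [|i _]; first exact: add_continuous.
by apply: cvgZr_tmp; exact: hf.
Qed.

(** Expand [u] in the standard basis: by linearity the differential is determined by its values on
    basis vectors, which are the partial derivatives. *)
Lemma diff_dot_gradient (R : realType) n (f : 'cV[R]_n -> R) (x u : 'cV[R]_n) :
  differentiable f x -> 'd f x u = dot (gradient f x) u.
Proof.
move=> df; rewrite {1}[u]matrix_sum_delta linear_sum /dot mxE; apply: eq_bigr => i _.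
by rewrite big_ord1 linearZ !mxE deriveE// mulrC.
Qed.

(** Chain rule through the curve [s] $\mapsto$ [(p s, v s)], whose velocity at [t] is [(dp, dv)]. *)
Lemma is_derive_comp2 (R : realType) n (f : 'cV[R]_n -> 'cV[R]_n -> R)
    (p v : R -> 'cV[R]_n) t (dp dv : 'cV[R]_n) :
  differentiable (fun y => f y.1 y.2) (p t, v t) ->
  is_derive t 1 p dp -> is_derive t 1 v dv ->
  is_derive t 1 (fun s => f (p s) (v s)) ('d (fun y => f y.1 y.2) (p t, v t) (dp, dv)).
Proof.
move=> hf [/derivable1_diffP dfp Dp] [/derivable1_diffP dfv Dv].
have dfpv := differentiable_pair dfp dfv.
have hc : differentiable (fun s => f (p s) (v s)) t.
  exact: (differentiable_comp dfpv hf).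
have D1E (W : normedModType R) (k : R -> W) : differentiable k t -> 'd k t 1 = 'D_1 k t.
  by move=> /deriveE ->.
split; first exact/derivable1_diffP.
rewrite -(D1E _ _ hc) (diff_comp dfpv hf) /= (diff_pair dfp dfv).
have Ep : 'd p t 1 = dp by rewrite D1E.
have Ev : 'd v t 1 = dv by rewrite D1E.
by congr ('d _ _ (_, _)).
Qed.

Arguments is_derive_comp2 {R n f p v t dp dv}.

Section CollisionCone.
Context {R : realType} (mu : 'cV[R]_3) (A : 'M[R]_3) (c : R).

(** The total differential of the barrier at [(p, v)] in the direction [(dp, dv)]; the signs of the
    [dp] terms come from $dr=-dp$. *)
Definition collision_cone_diff (p v dp dv : 'cV[R]_3) : R :=
  let r := mu - p in
  (bilin A dv v + bilin A v dv) * (bilin A r r - c ^+ 2)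
  - bilin A v v * (bilin A dp r + bilin A r dp)
  - 2 * bilin A r v * (bilin A r dv - bilin A dp v).

Lemma differentiable_collision_cone (V : normedModType R) (p v : V -> 'cV[R]_3) x :
  differentiable p x -> differentiable v x ->
  differentiable (fun y => collision_cone mu A c (p y) (v y)) x.
Proof.
move=> hp hv.
have hr : differentiable (fun y => mu - p y) x.
  exact: (differentiableB (differentiable_cst mu x) hp).
apply: differentiableB; last first.
  (* The rule is stated for the exponent [n.+1], so [1] selects the square. *)
  by apply: (@differentiableX _ _ _ 1); exact: differentiable_bilin.
apply: differentiableM; first exact: differentiable_bilin.
apply: differentiableB; last exact: differentiable_cst.
exact: differentiable_bilin.
Qed.

(** The domain [V] and direction [u] are arbitrary so that freezing one argument yields the partial
    derivatives in the other. *)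
Lemma is_derive_collision_cone (V : normedModType R) (p v : V -> 'cV[R]_3) x u
    (dp dv : 'cV[R]_3) :
  is_derive x u p dp -> is_derive x u v dv ->
  is_derive x u (fun y => collision_cone mu A c (p y) (v y))
    (collision_cone_diff (p x) (v x) dp dv).
Proof.
move=> hp hv.
have hr : is_derive x u (fun y => mu - p y) (- dp).
  by rewrite -(add0r (- dp)); exact: (is_deriveB (is_derive_cst mu x u) hp).
pose fvv y := bilin A (v y) (v y).
pose frr y := bilin A (mu - p y) (mu - p y).
pose frv y := bilin A (mu - p y) (v y).
have hvv : is_derive x u fvv _ := is_derive_bilin hv hv.
have hrr : is_derive x u frr _ := is_derive_bilin hr hr.
have hrv : is_derive x u frv _ := is_derive_bilin hr hv.
(* By conversion the barrier is a polynomial in three scalar functions; instance search then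
   differentiates it from [hvv], [hrr] and [hrv]. *)
have -> : (fun y => collision_cone mu A c (p y) (v y)) =
    fvv * (frr - cst (c ^+ 2)) - frv ^+ 2 by [].
apply: is_derive_eq.
have bNl y z : bilin A (- y) z = - bilin A y z.
  by rewrite /bilin linearN !mulNmx mxE.
have bNr y z : bilin A y (- z) = - bilin A y z.
  by rewrite /bilin mulmxN mxE.
rewrite /collision_cone_diff /= !bNl !bNr /GRing.scale /=.
rewrite !fctE /= /fvv /frr /frv; ring.
Qed.

Arguments is_derive_collision_cone {V p v x u dp dv}.

Lemma differentiable_fst (U V : normedModType R) (z : U * V) : differentiable fst z.
Proof. by apply: (@linear_differentiable _ _ _ fst) => ?; exact: cvg_fst. Qed.

Lemma differentiable_snd (U V : normedModType R) (z : U * V) : differentiable snd z.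
Proof. by apply: (@linear_differentiable _ _ _ snd) => ?; exact: cvg_snd. Qed.

(** Every partial derivative is [collision_cone_diff] in a basis direction, hence polynomial in
    [(p, v)] and continuous. *)
Lemma collision_cone_C1 : continuously_differentiable (collision_cone mu A c).
Proof.
have d1 (z : 'cV[R]_3 * 'cV[R]_3) : differentiable fst z by exact: differentiable_fst.
have d2 (z : 'cV[R]_3 * 'cV[R]_3) : differentiable snd z by exact: differentiable_snd.
have d0 w (z : 'cV[R]_3 * 'cV[R]_3) : differentiable (fun=> w : 'cV[R]_3) z.
  exact: differentiable_cst.
have dr (z : 'cV[R]_3 * 'cV[R]_3) : differentiable (fun y => mu - y.1) z.
  exact: (differentiableB (d0 mu z) (d1 z)).
pose dh dp dv (z : 'cV[R]_3 * 'cV[R]_3) := collision_cone_diff z.1 z.2 dp dv.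
have cdh dp dv : continuous (dh dp dv).
  move=> z; apply: differentiable_continuous.
  apply: differentiableB; [apply: differentiableB|]; apply: differentiableM.
  - by apply: differentiableD; exact: differentiable_bilin.
  - by apply: differentiableB; [exact: differentiable_bilin|exact: differentiable_cst].
  - exact: differentiable_bilin.
  - by apply: differentiableD; exact: differentiable_bilin.
  - by apply: differentiableM; [exact: differentiable_cst|exact: differentiable_bilin].
  - by apply: differentiableB; exact: differentiable_bilin.
split=> [z||].
- exact: differentiable_collision_cone.
- apply: continuous_col => i.
  (* With [v] frozen, the [i]-th partial in [p] is the differential in the direction $(e_i,0)$. *)
  rewrite (_ : (fun _ => _) = dh (delta_mx i 0) 0); first exact: cdh.
  apply/funext => z; rewrite mxE.
  by have [_ ->] := is_derive_collision_cone (is_derive_id z.1 (delta_mx i 0))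
    (is_derive_cst z.2 z.1 (delta_mx i 0)).
- apply: continuous_col => i.
  rewrite (_ : (fun _ => _) = dh 0 (delta_mx i 0)); first exact: cdh.
  apply/funext => z; rewrite mxE.
  by have [_ ->] := is_derive_collision_cone (is_derive_cst z.1 z.2 (delta_mx i 0))
    (is_derive_id z.2 (delta_mx i 0)).
Qed.
End CollisionCone.

Theorem proposition1 (R : realType)
    (m g : R) (hm : 0 < m) (hg : 0 < g)
    (mu : 'cV[R]_3) (A : 'M[R]_3) (c : R) (hA : sym_posdef A) (hc : 0 < c)
    (T : R -> R) (hT : forall s, 0 <= T s)
    (sigma a_cmd : R -> 'cV[R]_3) (t : R)
    (p v : R -> 'cV[R]_3) (hreal : quadrotor_dynamics m g T sigma p v t)
    (pDI vDI : R -> 'cV[R]_3) (hDI : double_integrator a_cmd pDI vDI t)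
    (hp : pDI t = p t) (hv : vDI t = v t) :
  let h := collision_cone mu A c in
  let h_real := fun s => h (p s) (v s) in
  let h_DI := fun s => h (pDI s) (vDI s) in
  let a_real := accel_real m g (T t) (sigma t) in
  let e_a := a_real - a_cmd t in
  [/\ continuously_differentiable h,
      derivable h_real t 1, derivable h_DI t 1 &
      'D_1 h_real t = 'D_1 h_DI t + dot (grad_v h (p t) (v t)) e_a].
Proof.
move=> h h_real h_DI a_real e_a.
have [dh _ _] := collision_cone_C1 mu A c.
case: hreal => Dp dv newton; case: hDI => DpDI DvDI.
have Dv : is_derive t 1 v a_real.
  (* Newton's law gives $m\dot v$; since $m\neq 0$, equality with [a_real] may be checked after
     scaling by [m]. *)
  split=> //; apply: (scalerI (lt0r_neq0 hm)); rewrite newton /a_real /accel_real.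
  by rewrite scalerDr !scalerA mulrN mulrC [m * _]mulrC divfK// gt_eqF.
have [d_real E_real] := is_derive_comp2 (dh (p t, v t)) Dp Dv.
have [d_DI E_DI] := is_derive_comp2 (dh (pDI t, vDI t)) DpDI DvDI.
split=> //; first exact: collision_cone_C1.
rewrite E_real E_DI hp hv.
set H := fun y : 'cV[R]_3 * 'cV[R]_3 => h y.1 y.2.
have dw : differentiable (fun w => h (p t) w) (v t).
  by apply: differentiable_collision_cone.
rewrite -diff_dot_gradient//.
(* The inclusion $w\mapsto(p(t),w)$ has differential $e\mapsto(0,e)$, so the chain rule identifies
   the partial differential in [v] with the total one on $(0,e_a)$. *)
have -> : 'd (fun w => h (p t) w) (v t) e_a = 'd H (p t, v t) (0, e_a).
  have dH : is_diff (p t, v t) H ('d H (p t, v t)) by exact: differentiableP.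
  have dk : is_diff (v t) (fun w => (p t, w)) (fun e => (0, e)) by exact: is_diff_pair.
  by have [_ /(congr1 (fun k => k e_a))] := is_diff_comp dk dH.
(* It remains to add directions: $(v,a_{\mathrm{cmd}})+(0,e_a)=(v,a_{\mathrm{real}})$. *)
rewrite -linearD; congr ('d _ _ _).
by rewrite /e_a; congr (_, _); rewrite /= ?addr0 ?hv // addrC subrK.
Qed.
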